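(* Let $G$ be a finite group and let $H$ be a subgroup of $G$. Then for every integer $n\ge 0$, $$|G:H|^{-2n}P_2(H,n)\leq P_2(G,n)\leq P_2(H,n),$$ and therefore, for every integer $n\ge 1$, $$|G:H|^{-1}k_n(H)\leq k_n(G)\leq |G:H|^n k_n(H).$$
   Context: For a finite group $K$ and an integer $n\ge 0$, $P_2(K,n)=|\mathrm{Hom}(\mathbb{Z}^n,K)|/|K|^n$, where $\mathrm{Hom}(\mathbb{Z}^n,K)$ is identified with the set of ordered $n$-tuples of pairwise commuting elements of $K$. For $n\ge 1$, $k_n(K)=|\mathrm{Hom}(\mathbb{Z}^n,K)/K|$ is the number of orbits of ordered commuting $n$-tuples in $K$ under simultaneous conjugation by $K$. *)

(* Defs.v *)
From mathcomp Require Import all_boot all_order all_algebra all_fingroup all_solvable.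

Set Implicit Arguments.
Unset Strict Implicit.
Unset Printing Implicit Defensive.

Import GRing.Theory Num.Theory.

(* Hom(Z^n, K), identified with the set of ordered n-tuples of pairwise
   commuting elements of K. *)
Definition commuting_tuples (gT : finGroupType) (K : {group gT}) (n : nat)
    : {set n.-tuple gT} :=
  [set t : n.-tuple gT |
    [forall i, tnth t i \in K] &&
    [forall i, forall j, (tnth t i * tnth t j == tnth t j * tnth t i)%g]].

Definition P2 (gT : finGroupType) (K : {group gT}) (n : nat) : rat :=
  (#|commuting_tuples K n|%:R / (#|K| ^ n)%:R)%R.

(* 'J * n is the action of gT on n-tuples by simultaneous conjugation. *)
Definition comm_class_number (gT : finGroupType) (n : nat) (K : {group gT})
    : nat :=
  #|orbit ('J * n)%act K @: commuting_tuples K n|.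

(* Main.v *)
Require Import Defs.
From mathcomp Require Import all_boot all_order all_algebra all_fingroup all_solvable.
From mathcomp Require Import ring.

(** Write c_n(K) for the number of commuting n-tuples of K. Both parts
    follow from
<<
        c_n(H) <= c_n(G) <= |G:H|^n c_n(H).
>>
    Dividing by |G|^n and |H|^n gives the bounds on P_2, the left one with a
    factor |G:H|^n to spare. For k_n, a commuting n-tuple fixed by x is a
    commuting n-tuple of the centraliser of x, so that Burnside's orbit
    counting formula reads k_n(K) |K| = c_(n+1)(K) ([card_orbits_commuting]):
    the bounds on k_n are those on c_(n+1), divided by |G|.

    The left inequality is an inclusion. The right one
    ([leq_card_commuting_tuples]) goes by induction on n, for all pairs of
    groups at once. Splitting off the first entry of a tuple,
    c_(n+1)(G) is the sum over x in G of c_n(C_G(x)), and the induction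
    hypothesis for C_H(x) inside C_G(x), whose index is at most |G:H|
    ([leq_index_setI]), replaces C_G(x) by C_H(x) at the cost of |G:H|^n.
    What remains counts the pairs (x, t) with t a commuting n-tuple of H and
    x in G centralising t; counted by t, it is a sum of orders |C_G(t)|, each
    at most |G:H| |C_H(t)|, and the sum of the latter is c_(n+1)(H). *)

Set Implicit Arguments.
Unset Strict Implicit.
Unset Printing Implicit Defensive.

Import Order.TTheory GRing.Theory Num.Theory GroupScope.

Section CommutingTuples.

Variable gT : finGroupType.
Implicit Types (G H K L : {group gT}) (n : nat) (x : gT).

Lemma commuting_tuplesP K n (t : n.-tuple gT) :
  reflect ({subset t <= K} /\ {in t &, forall y z, commute y z})
          (t \in commuting_tuples K n).
Proof.
rewrite inE; apply: (iffP andP) => [[/forallP tK /forallP tC]|[tK tC]].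
  split=> [y /tnthP[i ->] //|y z /tnthP[i ->] /tnthP[j ->]].
  by have /forallP/(_ j)/eqP := tC i.
split; apply/forallP=> i; first by rewrite tK ?mem_tnth.
by apply/forallP=> j; apply/eqP/tC; apply: mem_tnth.
Qed.

Lemma commuting_tuplesS H G n :
  H \subset G -> commuting_tuples H n \subset commuting_tuples G n.
Proof.
move=> sHG; apply/subsetP=> t /commuting_tuplesP[tH tC].
by apply/commuting_tuplesP; split=> // y /tH /(subsetP sHG).
Qed.

Lemma mem_commuting_tuples_cent1 K n x (t : n.-tuple gT) :
  (t \in commuting_tuples 'C_K[x] n) =
    (t \in commuting_tuples K n) && (x \in 'C([set y in t])).
Proof.
apply/commuting_tuplesP/andP => [[tKx tC]|[/commuting_tuplesP[tK tC] /centP xC]].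
  split; last by apply/centP=> y; rewrite inE => /tKx/setIP[_ /cent1P].
  by apply/commuting_tuplesP; split=> // y /tKx/setIP[].
split=> // y ty; rewrite inE tK //=.
by apply/cent1P/commute_sym/xC; rewrite inE.
Qed.

Lemma cons_commuting_tuples K n x (t : n.-tuple gT) :
  (cons_tuple x t \in commuting_tuples K n.+1) =
    (x \in K) && (t \in commuting_tuples 'C_K[x] n).
Proof.
rewrite mem_commuting_tuples_cent1.
apply/commuting_tuplesP/and3P => [[xtK xtC]|[xK]].
  split; first by rewrite xtK ?mem_head.
    apply/commuting_tuplesP; split=> [y ty|y z ty tz].
      by rewrite xtK // inE ty orbT.
    by apply: xtC; rewrite inE ?ty ?tz orbT.
  apply/centP=> y; rewrite inE => ty.
  by apply: xtC; rewrite inE ?eqxx // ty orbT.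
move=> /commuting_tuplesP[tK tC] /centP xC.
have xCt y : y \in t -> commute x y by move=> ty; apply: xC; rewrite inE.
split=> [y|y z]; rewrite !inE; first by case/predU1P=> [->|/tK].
case/predU1P=> [->|ty] /predU1P[->|tz] //.
- exact: xCt.
- exact/commute_sym/xCt.
- exact: tC.
Qed.

Lemma card_commuting_tuples0 K : #|commuting_tuples K 0| = 1%N.
Proof.
apply: (@eq_card1 _ [tuple]) => t; rewrite [t]tuple0 [RHS]inE eqxx.
by apply/commuting_tuplesP; split.
Qed.

Lemma card_commuting_tuplesS K n :
  #|commuting_tuples K n.+1| = (\sum_(x in K) #|commuting_tuples 'C_K[x] n|)%N.
Proof.
rewrite -sum1_card (partition_big (@thead n gT) (fun x => x \in K)) /= => [|t]; last first.
  by case/commuting_tuplesP=> tK _; apply/tK/mem_tnth.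
apply: eq_bigr => x xK; rewrite sum1dep_card.
have cons_inj : injective (fun t : n.-tuple gT => cons_tuple x t).
  by move=> t u /(congr1 val)[] tu; apply: val_inj.
rewrite -(card_imset _ cons_inj); apply: eq_card => t; rewrite inE.
apply/andP/imsetP => [[]|[u uC ->]].
  case/tupleP: t => y u; rewrite theadE => yuC /eqP yx; rewrite {y}yx in yuC *.
  by exists u => //; move: yuC; rewrite cons_commuting_tuples => /andP[].
by rewrite theadE cons_commuting_tuples xK uC.
Qed.

(** The double count that exchanges the roles of the extra element x and of
    the tuple t that it centralises. *)
Lemma sum_card_commuting_tuples_cent1 L H n :
  (\sum_(x in L) #|commuting_tuples 'C_H[x] n| =
     \sum_(t in commuting_tuples H n) #|'C_L([set y in t])|)%N.
Proof.
under eq_bigr => x _ do rewrite -sum1_card.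
rewrite (exchange_big_dep (fun t => t \in commuting_tuples H n)) /=.
  apply: eq_bigr => t tH; rewrite -sum1_card; apply: eq_bigl => x.
  by rewrite mem_commuting_tuples_cent1 tH inE.
by move=> x t _; rewrite mem_commuting_tuples_cent1 => /andP[].
Qed.

(** The cosets of H that meet K are among those that meet G. *)
Lemma leq_index_setI K G H : K \subset G -> (#|K : K :&: H| <= #|G : H|)%N.
Proof. by move=> sKG; rewrite indexgI subset_leq_card ?imsetS. Qed.

Lemma leq_index_subcent G H (A : {set gT}) :
  H \subset G -> (#|'C_G(A) : 'C_H(A)| <= #|G : H|)%N.
Proof.
move=> sHG; have := @leq_index_setI 'C_G(A) G H (subsetIl _ _).
by rewrite setIAC (setIidPr sHG).
Qed.

(** The induction is over all pairs G, H, since the inductive step applies the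
    bound to the centralisers in G and in H of an element of G. *)
Lemma leq_card_commuting_tuples G H n :
  H \subset G ->
  (#|commuting_tuples G n| <= #|G : H| ^ n * #|commuting_tuples H n|)%N.
Proof.
elim: n G H => [|n IHn] G H sHG; first by rewrite !card_commuting_tuples0.
rewrite card_commuting_tuplesS.
have le_x x : (#|commuting_tuples 'C_G[x] n| <=
               #|G : H| ^ n * #|commuting_tuples 'C_H[x] n|)%N.
  apply: leq_trans (IHn _ _ (setSI _ sHG)) _.
  rewrite leq_mul2r; apply/orP; right.
  have := leq_index_subcent [set x] sHG; rewrite cent_set1.
  by case: (n) => // m; rewrite leq_exp2r.
apply: (leq_trans (leq_sum _ (fun x _ => le_x x))).
(* One factor #|G : H| is left to pay for replacing x in G by x in H. *)
rewrite -big_distrr /= expnSr -mulnA leq_mul2l; apply/orP; right.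
rewrite card_commuting_tuplesS !sum_card_commuting_tuples_cent1 big_distrr /=.
apply: leq_sum => t _.
rewrite -(Lagrange (setSI 'C([set y in t]) sHG)) mulnC leq_mul2r.
by rewrite leq_index_subcent ?orbT.
Qed.

Lemma acts_commuting_tuples K n :
  [acts K, on commuting_tuples K n | 'J * n].
Proof.
apply/actsP=> a aK t; apply/idP/idP; last first.
  case/commuting_tuplesP=> tK tC; apply/commuting_tuplesP; split=> [y|y z] /=.
    case/mapP=> z tz ->; exact: groupJ (tK _ tz) aK.
  case/mapP=> y' ty -> /mapP[z' tz ->].
  by rewrite /commute -!conjMg (tC _ _ ty tz).
case/commuting_tuplesP=> tK tC; apply/commuting_tuplesP; split=> [y ty|y z ty tz].
  by rewrite -(groupJr y aK) tK //; apply: map_f.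
apply: (conjg_inj a); rewrite !conjMg; apply: tC; exact: map_f.
Qed.

Lemma afix_commuting_tuples K n x :
  'Fix_(commuting_tuples K n | 'J * n)[x] = commuting_tuples 'C_K[x] n.
Proof.
apply/setP=> t; rewrite mem_commuting_tuples_cent1 inE; congr (_ && _).
apply/afix1P/centP => [tx y|xC].
  rewrite inE => /tnthP[i ->]; apply/commute_sym/commgP/conjg_fixP.
  by rewrite -[in RHS]tx tnth_map.
apply: eq_from_tnth => i; rewrite tnth_map; apply/conjg_fixP/commgP/commute_sym.
by apply: xC; rewrite inE mem_tnth.
Qed.

(** Burnside's orbit counting formula, the fixed points being those of
    [afix_commuting_tuples]. *)
Lemma card_orbits_commuting K n :
  (comm_class_number n K * #|K| = #|commuting_tuples K n.+1|)%N.
Proof.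
rewrite /comm_class_number -(Frobenius_Cauchy (acts_commuting_tuples K n)).
rewrite card_commuting_tuplesS; apply: eq_bigr => x _.
by rewrite afix_commuting_tuples.
Qed.

End CommutingTuples.

Local Open Scope ring_scope.

Theorem proposition6p2 (gT : finGroupType) (G H : {group gT})
    (sHG : H \subset G) :
  (forall n : nat,
     (#|G : H|%g%:R : rat) ^- (2 * n) * P2 H n <= P2 G n <= P2 H n)
  /\
  (forall n : nat, (1 <= n)%N ->
     (#|G : H|%g%:R : rat)^-1 * (comm_class_number n H)%:R
       <= (comm_class_number n G)%:R
       <= (#|G : H|%g%:R : rat) ^+ n * (comm_class_number n H)%:R).
Proof.
have i_gt0 : (0 < #|G : H|%g%:R :> rat) by rewrite ltr0n indexg_gt0.
have h_gt0 : (0 < #|H|%:R :> rat) by rewrite ltr0n cardG_gt0.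
have cG : #|G|%:R = #|G : H|%g%:R * #|H|%:R :> rat.
  by rewrite -natrM mulnC Lagrange.
have leHG n : (#|commuting_tuples H n|%:R <= #|commuting_tuples G n|%:R :> rat).
  by rewrite ler_nat subset_leq_card ?commuting_tuplesS.
have leGH n : (#|commuting_tuples G n|%:R <=
               #|G : H|%g%:R ^+ n * #|commuting_tuples H n|%:R :> rat).
  by rewrite -natrX -natrM ler_nat leq_card_commuting_tuples.
split=> n; [|move=> _].
  rewrite /P2 !natrX cG exprMn mulnC exprM.
  have in_gt0 := exprn_gt0 n i_gt0; have hn_gt0 := exprn_gt0 n h_gt0.
  apply/andP; split.
    have in_ge1 : 1 <= #|G : H|%g%:R ^+ n :> rat.
      by rewrite exprn_ege1 // ler1n indexg_gt0.
    rewrite ler_pdivlMr ?mulr_gt0 //.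
    set i := _ ^+ n in in_gt0 in_ge1 *; set h := _ ^+ n in hn_gt0 *.
    have -> (c : rat) : i ^- 2 * (c / h) * (i * h) = c / i.
      by field; rewrite !gt_eqF.
    rewrite ler_pdivrMr //; apply: le_trans (leHG n) _.
    by rewrite ler_peMr // ler0n.
  by rewrite ler_pdivrMr ?mulr_gt0 // mulrCA divfK ?gt_eqF.
have burnside (K : {group gT}) :
    #|commuting_tuples K n.+1|%:R = (comm_class_number n K)%:R * #|K|%:R :> rat.
  by rewrite -natrM card_orbits_commuting.
have := leHG n.+1; have := leGH n.+1; rewrite !burnside cG => leGH1 leHG1.
apply/andP; split.
  by rewrite ler_pdivrMl // mulrC -(ler_pM2r h_gt0) -mulrA.
rewrite -(ler_pM2r (mulr_gt0 i_gt0 h_gt0)); apply: le_trans leGH1 _.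
by rewrite exprSr !mulrA [_ * _ * #|G : H|%g%:R]mulrAC.
Qed.
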